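(* Let $R$ be a nonzero commutative ring with identity, let $n\geq 1$, and let $\mathsf{T}(R^\times)$ be the torsion subgroup of the unit group $R^\times$. Then the subgroup \[ \mathsf{T}_{\bullet}(T_n(R)) = G_n(\mathsf{T}(R^\times)) \] of $T_n(R)$ is itself a generalized torsion group; that is, every element of $G_n(\mathsf{T}(R^\times))$ is a generalized torsion element of the group $G_n(\mathsf{T}(R^\times))$.
   Context: For a group $G$ and $g,x\in G$ write $g^x=x^{-1}gx$. An element $g\in G$ is generalized torsion in $G$ if there exist $k\geq 1$ and $x_1,\dots,x_k\in G$ with $g^{x_1}\cdots g^{x_k}=1$; $\mathsf{T}_{\bullet}(G)$ denotes the set of all such elements, and $G$ is a generalized torsion group if $\mathsf{T}_{\bullet}(G)=G$. $T_n(R)$ is the group of upper triangular $n\times n$ matrices over $R$ with diagonal entries in $R^\times$. For a subgroup $S\leq R^\times$, $G_n(S)$ is the subgroup of $T_n(R)$ consisting of the matrices whose diagonal entries all lie in $S$ (entries above the diagonal are arbitrary in $R$). *)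

(* Defs.v *)
From HB Require Import structures.
From mathcomp Require Import all_boot all_order all_algebra.
From mathcomp Require Import boolp classical_sets.

Set Implicit Arguments.
Unset Strict Implicit.
Unset Printing Implicit Defensive.

Import GRing.Theory.

Local Open Scope group_scope.
Local Open Scope classical_set_scope.

(* [g ^ x] is the library conjugate [conjg g x], i.e. [x^-1 * (g * x)]. *)
Definition gen_torsion (G : groupType) (g : G) : Prop :=
  exists (k : nat) (x : 'I_k -> G), (0 < k)%N /\ \prod_(i < k) g ^ x i = 1.

Definition Tbullet (G : groupType) : set G := [set g | gen_torsion g].
Arguments Tbullet : clear implicits.

Definition gen_torsion_group (G : groupType) : Prop := Tbullet G = [set: G].

(* The set of elements of finite order; it is registered below as a subgroup
   ([groupClosed]) when [G] is the unit group of a commutative ring. *)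
Definition torsion (G : groupType) : {pred G} :=
  [pred g | `[< exists2 k : nat, (0 < k)%N & g ^+ k = 1 >]].
Arguments torsion : clear implicits.

(* The elements of [S] as a type; it is a [groupType], with the operations of
   [G], when [S] is a subgroup (a [groupClosed] predicate). *)
Definition subgroup_type (G : groupType) (S : {pred G}) : Type :=
  {x : G | x \in S}.
Arguments subgroup_type : clear implicits.

Section SubgroupType.
Variables (G : groupType) (S : groupClosed G).

HB.instance Definition _ := SubChoice.on (subgroup_type G S).

Lemma subgroup_type_closed : group_closed (S : {pred G}).
Proof. by split; [exact: gpred1 | exact: gpredF]. Qed.

HB.instance Definition _ := SubChoice_isSubGroup.Build G
  (fun x => x \in S) (subgroup_type G S) subgroup_type_closed.

End SubgroupType.

Definition unit_group (R : comUnitRingType) : Type :=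
  {x : R | x \is a GRing.unit}.

Section UnitGroup.
Local Open Scope ring_scope.
Variable R : comUnitRingType.

HB.instance Definition _ := SubChoice.on (unit_group R).

Implicit Types u v w : unit_group R.

Definition ug_one : unit_group R := Sub 1 (unitr1 R).

Lemma ug_mul_subproof u v : val u * val v \is a GRing.unit.
Proof. by rewrite unitrM (valP u) (valP v). Qed.
Definition ug_mul u v : unit_group R := Sub (val u * val v) (ug_mul_subproof u v).

Lemma ug_inv_subproof u : (val u)^-1 \is a GRing.unit.
Proof. by rewrite unitrV (valP u). Qed.
Definition ug_inv u : unit_group R := Sub (val u)^-1 (ug_inv_subproof u).

Lemma ug_mulA : associative ug_mul.
Proof. by move=> u v w; apply: val_inj; rewrite /= mulrA. Qed.
Lemma ug_mul1 : left_id ug_one ug_mul.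
Proof. by move=> u; apply: val_inj; rewrite /= mul1r. Qed.
Lemma ug_mulr1 : right_id ug_one ug_mul.
Proof. by move=> u; apply: val_inj; rewrite /= mulr1. Qed.
Lemma ug_mulV : left_inverse ug_one ug_inv ug_mul.
Proof. by move=> u; apply: val_inj; rewrite /= mulVr // (valP u). Qed.
Lemma ug_mulrV : right_inverse ug_one ug_inv ug_mul.
Proof. by move=> u; apply: val_inj; rewrite /= divrr // (valP u). Qed.

HB.instance Definition _ := isGroup.Build (unit_group R)
  ug_mulA ug_mul1 ug_mulr1 ug_mulV ug_mulrV.

Lemma ug_mulC u v : (u * v = v * u)%g.
Proof. by apply: val_inj; rewrite /= mulrC. Qed.

End UnitGroup.

Section TorsionUnits.
Variable R : comUnitRingType.

Lemma torsion_unit_group1 : 1 \in torsion (unit_group R).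
Proof. by apply/asboolP; exists 1%N. Qed.

Lemma torsion_unit_groupM : mulg_closed (torsion (unit_group R)).
Proof.
move=> u v /asboolP[k k0 uk] /asboolP[l l0 vl]; apply/asboolP.
exists (k * l)%N; first by rewrite muln_gt0 k0.
rewrite expgMn; last exact: ug_mulC.
by rewrite expgnA uk expg1n mulnC expgnA vl expg1n mulg1.
Qed.

Lemma torsion_unit_groupV : invg_closed (torsion (unit_group R)).
Proof.
move=> u /asboolP[k k0 uk]; apply/asboolP; exists k => //.
by rewrite expVgn uk invg1.
Qed.

(* The order matters: the [UMagmaClosed] and [GroupClosed] instances are not
   found when [isMul1Closed] is declared first. *)
HB.instance Definition _ :=
  isMulClosed.Build (unit_group R) (torsion (unit_group R))
    torsion_unit_groupM.
HB.instance Definition _ :=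
  isMul1Closed.Build (unit_group R) (torsion (unit_group R))
    torsion_unit_group1.
HB.instance Definition _ :=
  isInvClosed.Build (unit_group R) (torsion (unit_group R))
    torsion_unit_groupV.

End TorsionUnits.

(* Upper triangular with unit diagonal entries; the library predicate
   [is_trig_mx] means lower triangular, hence is not used here. *)
Definition triu_unit (R : comUnitRingType) (n : nat) : pred 'M[R]_n :=
  fun A => [forall i : 'I_n, forall j : 'I_n, (j < i)%N ==> (A i j == 0%R)]
           && [forall i, A i i \is a GRing.unit].

Definition triu_group (R : comUnitRingType) (n : nat) : Type :=
  {A : 'M[R]_n | triu_unit A}.

Section TriuGroup.
Local Open Scope ring_scope.
Variables (R : comUnitRingType) (n : nat).

HB.instance Definition _ := SubChoice.on (triu_group R n).

Implicit Types A B C : 'M[R]_n.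

Lemma triu_unitP A :
  reflect ((forall i j : 'I_n, (j < i)%N -> A i j = 0)
           /\ (forall i, A i i \is a GRing.unit)) (triu_unit A).
Proof.
apply: (iffP andP) => [[/forallP A0 /forallP Au]|[A0 Au]]; split=> //.
- by move=> i j ji; have /forallP/(_ j)/implyP/(_ ji)/eqP := A0 i.
- by apply/forallP=> i; apply/forallP=> j; apply/implyP=> ji; rewrite A0.
- exact/forallP.
Qed.

Lemma triu_mul_diag A B : triu_unit A -> triu_unit B ->
  forall i, (A *m B) i i = A i i * B i i.
Proof.
move=> /triu_unitP[A0 _] /triu_unitP[B0 _] i.
rewrite mxE (bigD1 i) //= big1 ?addr0 // => k; rewrite neq_ltn => /orP[] ki.
- by rewrite A0 // mul0r.
- by rewrite B0 // mulr0.
Qed.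

Lemma triu_unit1 : triu_unit (1%:M : 'M[R]_n).
Proof.
apply/triu_unitP; split=> [i j ji|i]; rewrite !mxE ?eqxx ?unitr1 //.
by rewrite -val_eqE /= gtn_eqF.
Qed.

Lemma triu_unitM A B : triu_unit A -> triu_unit B -> triu_unit (A *m B).
Proof.
move=> tA tB; have dAB := triu_mul_diag tA tB.
move: tA tB => /triu_unitP[A0 Au] /triu_unitP[B0 Bu].
apply/triu_unitP; split=> [i j ji|i]; last by rewrite dAB unitrM Au Bu.
rewrite mxE big1 // => k _; have [ki|ik] := ltnP k i.
- by rewrite A0 // mul0r.
- by rewrite B0 ?mulr0 // (leq_trans ji).
Qed.

Lemma triu_unitmx A : triu_unit A -> A \in unitmx.
Proof.
move=> /triu_unitP[A0 Au]; rewrite unitmxE -det_tr det_trig.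
  by apply: (big_ind (fun x => x \is a GRing.unit)) => [|x y xu yu|i _];
    rewrite ?unitr1 ?unitrM ?xu ?yu // mxE.
by apply/is_trig_mxP=> i j ij; rewrite mxE A0.
Qed.

Lemma triu_unitV A : triu_unit A -> triu_unit (invmx A).
Proof.
move=> tA; have uA := triu_unitmx tA; have BA := mulVmx uA.
move: tA => /triu_unitP[A0 Au]; set B := invmx A in BA *.
have BAE i j : \sum_k B i k * A k j = (i == j)%:R.
  by have := congr1 (fun M : 'M[R]_n => M i j) BA; rewrite !mxE.
have B0 (i j : 'I_n) : (j < i)%N -> B i j = 0.
  have [m] := ubnP j; elim: m j => // m IH j jm ji.
  have := BAE i j; rewrite -val_eqE /= gtn_eqF // (bigD1 j) //= big1.
    rewrite addr0 => /(congr1 (fun x => x * (A j j)^-1)).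
    by rewrite mulrK // mul0r.
  move=> k; rewrite neq_ltn => /orP[] kj; last by rewrite A0 // mulr0.
  by rewrite IH ?mul0r ?(ltn_trans kj ji) ?(leq_trans kj).
apply/triu_unitP; split=> // i; apply/unitrPr; exists (A i i).
have := BAE i i; rewrite eqxx (bigD1 i) //= big1 ?addr0 // => k.
by rewrite neq_ltn => /orP[] ki; [rewrite B0 // mul0r | rewrite A0 // mulr0].
Qed.

Implicit Types a b c : triu_group R n.

Definition tg_one : triu_group R n := Sub 1%:M triu_unit1.
Definition tg_mul a b : triu_group R n :=
  Sub (val a *m val b) (triu_unitM (valP a) (valP b)).
Definition tg_inv a : triu_group R n :=
  Sub (invmx (val a)) (triu_unitV (valP a)).

Lemma tg_mulA : associative tg_mul.
Proof. by move=> a b c; apply: val_inj; rewrite /= mulmxA. Qed.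
Lemma tg_mul1 : left_id tg_one tg_mul.
Proof. by move=> a; apply: val_inj; rewrite /= mul1mx. Qed.
Lemma tg_mulr1 : right_id tg_one tg_mul.
Proof. by move=> a; apply: val_inj; rewrite /= mulmx1. Qed.
Lemma tg_mulV : left_inverse tg_one tg_inv tg_mul.
Proof.
by move=> a; apply: val_inj; rewrite /= mulVmx // triu_unitmx // (valP a).
Qed.
Lemma tg_mulrV : right_inverse tg_one tg_inv tg_mul.
Proof.
by move=> a; apply: val_inj; rewrite /= mulmxV // triu_unitmx // (valP a).
Qed.

HB.instance Definition _ := isGroup.Build (triu_group R n)
  tg_mulA tg_mul1 tg_mulr1 tg_mulV tg_mulrV.

Lemma triu_diag_subproof a i : val a i i \is a GRing.unit.
Proof. by have /triu_unitP[_] := valP a; apply. Qed.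

Definition triu_diag a (i : 'I_n) : unit_group R :=
  Sub (val a i i) (triu_diag_subproof a i).

Lemma triu_diag1 i : triu_diag 1%g i = 1%g.
Proof. by apply: val_inj; rewrite /= mxE eqxx. Qed.

Lemma triu_diagM a b i :
  triu_diag (a * b)%g i = (triu_diag a i * triu_diag b i)%g.
Proof. by apply: val_inj; apply: triu_mul_diag; apply: valP. Qed.

Lemma triu_diagV a i : triu_diag a^-1%g i = (triu_diag a i)^-1%g.
Proof.
by apply: (@mulgI _ (triu_diag a i)); rewrite -triu_diagM !mulgV triu_diag1.
Qed.

End TriuGroup.

Definition Gn (R : comUnitRingType) (n : nat) (S : {pred unit_group R}) :
    {pred triu_group R n} :=
  [pred A | [forall i, triu_diag A i \in S]].
Arguments Gn : clear implicits.

Section GnClosed.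
Variables (R : comUnitRingType) (n : nat) (S : groupClosed (unit_group R)).

Lemma Gn1 : 1 \in Gn R n S.
Proof. by apply/forallP=> i; rewrite triu_diag1 gpred1. Qed.

Lemma GnM : mulg_closed (Gn R n S).
Proof.
move=> A B /forallP AS /forallP BS; apply/forallP=> i.
by rewrite triu_diagM gpredM.
Qed.

Lemma GnV : invg_closed (Gn R n S).
Proof. by move=> A /forallP AS; apply/forallP=> i; rewrite triu_diagV gpredVr. Qed.

HB.instance Definition _ := isMulClosed.Build (triu_group R n) (Gn R n S) GnM.
HB.instance Definition _ := isMul1Closed.Build (triu_group R n) (Gn R n S) Gn1.
HB.instance Definition _ := isInvClosed.Build (triu_group R n) (Gn R n S) GnV.

End GnClosed.

(* Main.v *)
Require Import Defs.
From mathcomp Require Import all_boot all_order all_algebra.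
From mathcomp Require Import boolp classical_sets.

Local Open Scope classical_set_scope.

(** The diagonal of a product of conjugates of [A] is a power of the diagonal of
[A], so generalized torsion elements of [T_n(R)] have torsion diagonal entries.
Conversely, a matrix with torsion diagonal has a unitriangular power. If [U] is
unitriangular and its first [r - 1] superdiagonals vanish, conjugating [U] by
the diagonal matrix with entries [(-1)^(i/r)], which lies in [G_n(T(R^x))],
changes the sign of the [r]-th superdiagonal; hence the [r]-th superdiagonal of
[U * U^D] vanishes too. Iterating kills everything above the diagonal. *)

Section GeneralizedTorsion.
Local Open Scope group_scope.

Lemma gen_torsionP (G : groupType) (g : G) :
  gen_torsion g <-> exists2 s : seq G, (0 < size s)%N & \prod_(x <- s) g ^ x = 1.
Proof.
split=> [[k [x [k0 gx]]]|[s s0 gs]].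
  exists [seq x i | i <- index_enum 'I_k]; last by rewrite (@big_map _ 1 *%g).
  by rewrite size_map [index_enum _]unlock -enumT size_enum_ord.
by exists (size s), (tnth (in_tuple s)); split=> //; rewrite -[RHS]gs [RHS](@big_tnth _ 1 *%g).
Qed.

Lemma gen_torsion1 (G : groupType) : gen_torsion (1 : G).
Proof. by apply/gen_torsionP; exists [:: 1]; rewrite // big_seq1 conj1g. Qed.

(** Conjugation by [y] is an endomorphism and [(g ^ x) ^ y = g ^ (x * y)], so nested products of
    conjugates of [g] flatten. *)
Lemma gen_torsion_prod_conj (G : groupType) (g : G) (s : seq G) :
  (0 < size s)%N -> gen_torsion (\prod_(x <- s) g ^ x) -> gen_torsion g.
Proof.
move=> s0 /gen_torsionP[t t0 gt]; apply/gen_torsionP.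
exists [seq x * y | y <- t, x <- s]; first by rewrite size_allpairs muln_gt0 t0.
rewrite big_allpairs_dep -[RHS]gt; apply: eq_bigr => y _.
by rewrite conjg_prod; apply: eq_bigr => x _; rewrite conjgM.
Qed.

Lemma gen_torsion_mul_conj (G : groupType) (g x : G) :
  gen_torsion (g * g ^ x) -> gen_torsion g.
Proof.
move=> gx; apply: (@gen_torsion_prod_conj _ _ [:: 1; x]) => //.
by rewrite !big_cons big_nil conjg1 mulg1.
Qed.

Lemma gen_torsion_expg (G : groupType) (g : G) (k : nat) :
  (0 < k)%N -> gen_torsion (g ^+ k) -> gen_torsion g.
Proof.
move=> k0 gk; apply: (@gen_torsion_prod_conj _ _ (nseq k 1)).
  by rewrite size_nseq.
suff -> : \prod_(x <- nseq k 1) g ^ x = g ^+ k by [].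
elim: k {k0 gk} => [|k IH]; first by rewrite big_nil.
by rewrite big_cons IH conjg1 expgS.
Qed.

Lemma gen_torsion_val (G : groupType) (S : groupClosed G)
  (g : subgroup_type G S) : gen_torsion g -> gen_torsion (val g).
Proof.
move=> [k [x [k0 gx]]]; exists k, (val \o x); split=> //.
have := congr1 val gx; rewrite gmulf_prod val1 => gx1.
by rewrite -[RHS]gx1; apply: eq_bigr => i _; rewrite gmulfJ.
Qed.

End GeneralizedTorsion.

Section UnitriangularBand.
Local Open Scope ring_scope.
Import GRing.Theory.
Variables (R : comUnitRingType) (n : nat).
Implicit Types A B : 'M[R]_n.

(* For [0 < r]: unitriangular with vanishing superdiagonals [1], ..., [r - 1]. *)
Definition unitri_band (r : nat) A : Prop :=
  forall i j : 'I_n, (j < i + r)%N -> A i j = (i == j)%:R.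

Lemma unitri_band_full A : unitri_band n A -> A = 1%:M.
Proof.
by move=> A1; apply/matrixP=> i j; rewrite mxE A1 // ltn_addl.
Qed.

(** With [A = 1 + X] and [B = 1 + Y], only [X *m Y] has to vanish here: [X i k] is zero unless
    [i + r <= k], and then [j <= k < k + r] forces [Y k j = 0]. *)
Lemma unitri_bandM r A B : (0 < r)%N -> unitri_band r A -> unitri_band r B ->
  forall i j : 'I_n, (j <= i + r)%N ->
    (A *m B) i j = A i j + B i j - (i == j)%:R.
Proof.
move=> r0 A1 B1 i j ij.
have -> : A *m B = A + B - 1%:M + (A - 1%:M) *m (B - 1%:M).
  rewrite mulmxBl !mulmxBr !mulmx1 mul1mx -[A + B - _]addrA -[_ - A - _]addrA.
  by rewrite -opprD subrKC.
rewrite !mxE big1 ?addr0 // => k _; rewrite !mxE.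
have [ki|ik] := ltnP k (i + r); first by rewrite A1 // subrr mul0r.
by rewrite B1 ?subrr ?mulr0 // (leq_ltn_trans ij) // (leq_ltn_trans ik) // -addn1 leq_add2l.
Qed.

Definition sign_mx (s : 'I_n -> bool) : 'M[R]_n := diag_mx (\row_i (-1) ^+ s i).

Lemma sign_mx_conjE (s : 'I_n -> bool) A i j :
  (sign_mx s *m (A *m sign_mx s)) i j = (-1) ^+ (s i (+) s j) * A i j.
Proof. by rewrite mul_diag_mx mul_mx_diag !mxE signr_addb mulrCA mulrC. Qed.

Lemma sign_mx_sqr (s : 'I_n -> bool) : sign_mx s *m sign_mx s = 1%:M.
Proof.
apply/matrixP=> i j; rewrite mul_diag_mx !mxE.
by case: eqP => [->|_]; rewrite ?mulr0n ?mulr0 // -signr_addb addbb.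
Qed.

Lemma sign_mx_triu (s : 'I_n -> bool) : triu_unit (sign_mx s).
Proof.
apply/triu_unitP; split=> [i j ji|i]; rewrite !mxE.
  by rewrite -val_eqE /= gtn_eqF.
by rewrite eqxx mulr1n unitrX ?unitrN1.
Qed.

(** Passing from [i] to [i + r] raises [i %/ r] by exactly one, so indices at distance [r] always
    get opposite signs. *)
Definition block_sign (r : nat) (i : 'I_n) : bool := odd (i %/ r).

Lemma unitri_bandS r A : (0 < r)%N -> unitri_band r A ->
  unitri_band r.+1 (A *m (sign_mx (block_sign r) *m (A *m sign_mx (block_sign r)))).
Proof.
move=> r0 A1; set D := sign_mx _.
have conjE i j : (D *m (A *m D)) i j = _ := sign_mx_conjE _ A i j.
have B1 : unitri_band r (D *m (A *m D)).
  move=> i j ij; rewrite conjE A1 //.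
  by case: eqP => [->|_]; rewrite ?mulr0 // addbb mul1r.
move=> i j; rewrite addnS ltnS => ij; rewrite (unitri_bandM r) //.
(* Before the [r]-th superdiagonal both factors agree with the identity; on it, where [j = i + r],
   their entries are opposite and cancel. *)
have [jir|irj] := ltnP j (i + r); first by rewrite A1 // B1 // addrK.
have jE : j = (i + r)%N :> nat by apply/eqP; rewrite eqn_leq ij.
rewrite conjE /block_sign jE divnDr // divnn r0 addn1 /= addbN addbb expr1 mulN1r.
have ij' : (i < j)%N by rewrite jE -[X in (X < _)%N]addn0 ltn_add2l.
by rewrite subrr -val_eqE /= ltn_eqF // subr0.
Qed.

End UnitriangularBand.

Section UnitriangularGroup.
Local Open Scope group_scope.
Variables (R : comUnitRingType) (n : nat) (S : groupClosed (unit_group R)).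
(** Puts the sign matrices into [Gn R n S], so that the conjugators come from the subgroup
    itself. *)
Hypothesis involutions_in_S : forall u : unit_group R, u * u = 1 -> u \in (S : {pred _}).

Definition triu_sign (s : 'I_n -> bool) : triu_group R n :=
  Sub (sign_mx R n s) (sign_mx_triu R n s).

Lemma triu_sign_sqr s : triu_sign s * triu_sign s = 1.
Proof. by apply: val_inj; rewrite /= sign_mx_sqr. Qed.

Lemma triu_sign_Gn s : triu_sign s \in Gn R n S.
Proof.
by apply/forallP=> i; apply: involutions_in_S; rewrite -triu_diagM triu_sign_sqr triu_diag1.
Qed.

Lemma unitri_gen_torsion (r : nat) (g : subgroup_type (triu_group R n) (Gn R n S)) :
  (0 < r)%N -> unitri_band R n r (val (val g)) -> gen_torsion g.
Proof.
(* Induction on [n - r]: each step clears one more superdiagonal, and from [r = n] on the band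
   condition leaves only the identity. *)
have [m] := ubnP (n - r); elim: m r g => // m IH r g nr r0 gr.
have [rn|rn] := leqP n r.
  suff -> : g = 1 by apply: gen_torsion1.
  apply: val_inj; apply: val_inj; apply: unitri_band_full => i j ij.
  by apply: gr; rewrite (leq_trans ij) // leq_add2l.
pose d : subgroup_type (triu_group R n) (Gn R n S) :=
  Sub (triu_sign (block_sign n r)) (triu_sign_Gn _).
apply: (@gen_torsion_mul_conj _ _ d); apply: (IH r.+1) => //.
  exact: leq_trans (ltn_sub2l rn (ltnSn r)) nr.
(* Since [d] is an involution, [g * g ^ d] takes the form treated in [unitri_bandS]. *)
have dV : d^-1 = d.
  apply: (@mulgI _ d); rewrite mulgV.
  by apply: val_inj; apply: val_inj; rewrite /= sign_mx_sqr.
rewrite conjgE dV.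
exact: unitri_bandS.
Qed.

End UnitriangularGroup.

Section DiagonalTorsion.
Local Open Scope group_scope.
Variables (R : comUnitRingType) (n : nat).
Implicit Types a : triu_group R n.

Lemma triu_diag_prod (I : Type) (s : seq I) (F : I -> triu_group R n) i :
  triu_diag (\prod_(k <- s) F k) i = \prod_(k <- s) triu_diag (F k) i.
Proof.
apply: (big_morph (fun a => triu_diag a i)) => [a b|].
  exact: triu_diagM.
exact: triu_diag1.
Qed.

Lemma triu_diagX a k i : triu_diag (a ^+ k) i = triu_diag a i ^+ k.
Proof. by elim: k => [|k IH]; rewrite ?triu_diag1 // !expgS triu_diagM IH. Qed.

(** Diagonal entries multiply in the commutative unit group, where conjugation is trivial. *)
Lemma triu_diagJ a b i : triu_diag (a ^ b) i = triu_diag a i.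
Proof. by rewrite !triu_diagM triu_diagV ug_mulC -mulgA mulgV mulg1. Qed.

Lemma gen_torsion_triu_diag a i :
  gen_torsion a -> triu_diag a i \in torsion (unit_group R).
Proof.
move=> [k [x [k0 ax]]]; apply/asboolP; exists k => //.
have := congr1 (fun b => triu_diag b i) ax.
rewrite triu_diag_prod triu_diag1 => ax1.
rewrite -[RHS]ax1 -[in LHS](card_ord k) -prodg_const.
by apply: eq_bigr => j _; rewrite triu_diagJ.
Qed.

Lemma torsion_diag_exponent a : a \in Gn R n (torsion (unit_group R)) ->
  exists2 m : nat, (0 < m)%N & forall i, triu_diag (a ^+ m) i = 1.
Proof.
move=> /forallP at_; have /choice[k kP] : forall i, exists k : nat,
    (0 < k)%N /\ triu_diag a i ^+ k = 1.
  by move=> i; have /asboolP[k] := at_ i; exists k.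
(* The product of the chosen exponents is a common multiple that works for every diagonal entry. *)
exists (\prod_i k i)%N => [|i]; first by rewrite prodn_gt0 // => i; case: (kP i).
by rewrite triu_diagX (bigD1 i) //= expgnA (proj2 (kP i)) expg1n.
Qed.

End DiagonalTorsion.

Theorem mainTheorem3 (R : comUnitRingType) (n : nat) (hn : (0 < n)%N) :
  Tbullet (triu_group R n) = [set` Gn R n (torsion (unit_group R))]
  /\ gen_torsion_group
       (subgroup_type (triu_group R n) (Gn R n (torsion (unit_group R)))).
Proof.
(* Proved inside the subgroup, this gives the second claim and, through [gen_torsion_val], one
   inclusion of the first. *)
have GnT (g : subgroup_type _ (Gn R n (torsion (unit_group R)))) : gen_torsion g.
  have [m m0 gm] := torsion_diag_exponent R n (val g) (valP g).
  (* A band with [r = 1] is plain unitriangularity, which holds for [g ^+ m]. *)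
  apply: (@gen_torsion_expg _ _ m m0); apply: (@unitri_gen_torsion _ _ _ _ 1) => //.
    by move=> u uu; apply/asboolP; exists 2.
  move=> i j; rewrite addn1 ltnS leq_eqVlt gmulfXn => /orP[/eqP/val_inj ->|ji].
    by rewrite eqxx; exact: (congr1 val (gm i)).
  have /triu_unitP[-> //] := valP (val g ^+ m)%g.
  by rewrite -val_eqE /= gtn_eqF.
split; last by apply/seteqP; split=> // g _; exact: GnT.
apply/seteqP; split=> a /= aT.
  by apply/forallP=> i; apply: gen_torsion_triu_diag.
exact: (gen_torsion_val _ _ (Sub a aT) (GnT _)).
Qed.
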